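(* Let $G\neq\delta_0$ be a probability measure on $[0,\infty)$ and let $t_0:=\inf\{x: G([0,x])>0\}$. Then the point $(0,1)$ lies on a flat edge of the limit shape $\mathcal B_G$ if and only if $G(\{t_0\})>0$.
   Context: Model: Let $G$ be a probability measure on $[0,\infty)$. In the nearest-neighbour lattice $\mathbb Z^2$, every vertical edge (joining $(x,y)$ and $(x,y+1)$) receives the deterministic weight $\tau_e=1$, and every horizontal edge (joining $(x,y)$ and $(x+1,y)$) receives a random weight $\tau_e$, the horizontal weights being independent with law $G$. A path is a sequence $p=(z_0,z_1,\dots)$ of points of $\mathbb Z^2$ with $z_k,z_{k+1}$ joined by an edge; an edge $e$ lies in $p$ if $e=(z_k,z_{k+1})$ for some $k$. The passage time is $T(p)=\sum_{e\in p}\tau_e$, and for $u,w\in\mathbb Z^2$, $T(u,w)=\inf_p T(p)$ over paths from $u$ to $w$. For $v\ge0$, the time constant $\Lambda(v)=\lim_{n\to\infty}\frac1n T((0,0),(n,\lceil vn\rceil))$ exists almost surely, is deterministic, convex, and $\Lambda(v)>0$ for all $v\ge 0$ when $G\neq\delta_0$. Limit shape: for $0\le\theta<\pi/2$ set $\mathcal B(\theta)=\frac{1}{\Lambda(\tan\theta)\cos\theta}$, extended continuously to $\theta=\pi/2$ (where the value is $1$). The limit shape $\mathcal B_G$ is the closed region bounded by the four symmetric curves $\mathcal B(\theta)e^{i\theta}$, $\mathcal B(\theta)e^{-i\theta}$, $-\mathcal B(\theta)e^{i\theta}$, $-\mathcal B(\theta)e^{-i\theta}$ ($0\le\theta\le\pi/2$,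 identifying $\mathbb R^2$ with $\mathbb C$), whose union is the boundary $\partial\mathcal B_G$. A point $x\in\partial\mathcal B_G$ lies on a flat edge if there is $y\in\partial\mathcal B_G\setminus\{x\}$ such that the segment from $x$ to $y$ is contained in $\partial\mathcal B_G$. *)

(* Defs.v *)
From HB Require Import structures.
From mathcomp Require Import all_boot all_order all_algebra.
From mathcomp Require Import all_classical all_reals all_analysis.
Set Implicit Arguments. Unset Strict Implicit. Unset Printing Implicit Defensive.
Import Order.TTheory GRing.Theory Num.Theory.
Import numFieldNormedType.Exports.
Local Open Scope classical_set_scope.
Local Open Scope ring_scope.

Definition pt := (int * int)%type.

Definition adjacent (z w : pt) : bool :=
  ((z.1 == w.1) && ((w.2 == z.2 + 1) || (z.2 == w.2 + 1))) ||
  ((z.2 == w.2) && ((w.1 == z.1 + 1) || (z.1 == w.1 + 1))).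

(* Canonical label of the (unordered) edge joining two adjacent points:
   (false, (x,y)) = vertical edge joining (x,y) and (x,y+1);
   (true,  (x,y)) = horizontal edge joining (x,y) and (x+1,y). *)
Definition edge_of (z w : pt) : bool * pt :=
  if z.1 == w.1 then (false, (z.1, Order.min z.2 w.2))
  else (true, (Order.min z.1 w.1, z.2)).

Definition lattice_path (u w : pt) (p : seq pt) : Prop :=
  [/\ head u p = u, last u p = w, p != [::] & path adjacent u (behead p)].

Definition path_edges (u : pt) (p : seq pt) : seq (bool * pt) :=
  undup (pairmap edge_of (head u p) (behead p)).

Section FPP.
Context {R : realType}.

(* Edge weight: vertical edges have weight 1, horizontal edge with left
   endpoint z has weight tau z. *)
Definition edge_weight (tau : pt -> R) (e : bool * pt) : R :=
  if e.1 then tau e.2 else 1.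

Definition passage_time_path (tau : pt -> R) (u : pt) (p : seq pt) : R :=
  \sum_(e <- path_edges u p) edge_weight tau e.

Definition passage_time (tau : pt -> R) (u w : pt) : R :=
  inf [set passage_time_path tau u p | p in [set p | lattice_path u w p]].

Definition mutually_independent {d} {Omega : measurableType d} {I : eqType}
  (P : probability Omega R) (X : I -> Omega -> R) : Prop :=
  forall (s : seq I) (A : I -> set R), uniq s ->
    (forall i, measurable (A i)) ->
    fine (P (\bigcap_(i in [set` s]) (X i @^-1` A i))) =
    \prod_(i <- s) fine (P (X i @^-1` A i)).

Definition iid_weights {d} {Omega : measurableType d}
  (P : probability Omega R) (G : probability R R) (tau : pt -> Omega -> R) : Prop :=
  [/\ forall z, measurable_fun setT (tau z),
      forall z (A : set R), measurable A -> P (tau z @^-1` A) = G A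
    & mutually_independent P tau].

Definition is_time_constant {d} {Omega : measurableType d}
  (P : probability Omega R) (tau : pt -> Omega -> R) (Lambda : R -> R) : Prop :=
  forall v : R, 0 <= v ->
    {ae P, forall w, (fun n : nat =>
        passage_time (fun z => tau z w) (0, 0) (n%:Z, Num.ceil (v * n%:R)) / n%:R)
        @ \oo --> Lambda v}.

Definition shape_radius (Lambda : R -> R) (theta : R) : R :=
  if theta == pi / 2 then 1 else (Lambda (tan theta) * cos theta)^-1.

Definition shape_boundary (Lambda : R -> R) : set (R * R) :=
  [set z | exists theta, 0 <= theta <= pi / 2 /\
     exists (s1 s2 : R), (s1 = 1 \/ s1 = -1) /\ (s2 = 1 \/ s2 = -1) /\
       z = (s1 * (shape_radius Lambda theta * cos theta),
            s2 * (shape_radius Lambda theta * sin theta))].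

Definition segment (x y : R * R) : set (R * R) :=
  [set z | exists t, 0 <= t <= 1 /\
     z = ((1 - t) * x.1 + t * y.1, (1 - t) * x.2 + t * y.2)].

Definition on_flat_edge (B : set (R * R)) (x : R * R) : Prop :=
  B x /\ exists y, B y /\ y <> x /\ segment x y `<=` B.

End FPP.

(* Main.v *)
(** A boundary point in direction [v = tan theta] is [(1 / Lambda v, v / Lambda v)],
    so a segment of the boundary starting at [(0, 1)] means that [Lambda v = v + c]
    for all large [v].  Always [Lambda v >= v + t0], since a path to [(n, vn)] uses
    [vn] vertical edges and [n] horizontal edges of weight at least [t0].

    If [G A > 0] and [A] is bounded by [a], the greedy path that goes up until it
    meets an edge with weight in [A] and then crosses it has bounded average slope,
    so [Lambda v <= v + a] for large [v].  With [A = {t0}] this gives the flat edge,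
    and with [A = ]-oo, t0 + e]] it forces [c = t0].

    If [G {t0} = 0], then [Lambda v > v + t0] for every [v].  Keep of a simple path
    only its vertical steps and the horizontal steps into a new maximal column: this
    is a word of length [O(n)], so there are at most [4 ^ (K n)] of them, while a cost
    below [(v + t0 + e / 2) n] forces half of the columns to be crossed at weight at
    most [t0 + e], which has probability at most [G (]-oo, t0 + e]) ^ (n / 2)].
    For small [e] the union bound is summable. *)

From Pilot Require (* Again, because [sequences] also defines [adjacent]. *)
Import Defs.
From HB Require Import structures.
From mathcomp Require Import all_boot all_order all_algebra.
From mathcomp Require Import all_classical all_reals all_analysis.
From mathcomp Require Import zify lra ring.
Set Implicit Arguments. Unset Strict Implicit. Unset Printing Implicit Defensive.
Import Order.TTheory GRing.Theory Num.Theory.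
Import numFieldNormedType.Exports.
Import Defs.
Local Open Scope classical_set_scope.
Local Open Scope ring_scope.

(** * Words of fixed length and their weighted sums *)

Section Words.
Context {T : Type}.

Fixpoint words (L : seq T) (n : nat) : seq (seq T) :=
  if n is n'.+1 then [seq x :: w | x <- L, w <- words L n'] else [:: [::]].

(** Distributivity: expanding the power gives one term per word. The union bounds use it to sum
    letterwise weights over all words. *)
Lemma sum_words_prod (R : comPzRingType) (L : seq T) (f : T -> R) (n : nat) :
  \sum_(w <- words L n) \prod_(x <- w) f x = (\sum_(x <- L) f x) ^+ n.
Proof.
elim: n => [|n IH] /=; first by rewrite big_seq1 big_nil expr0.
rewrite big_allpairs_dep exprS -IH mulr_suml; apply: eq_bigr => x _.
by rewrite mulr_sumr; apply: eq_bigr => w _; rewrite big_cons.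
Qed.
End Words.

Lemma mem_words (T : eqType) (L : seq T) (n : nat) (w : seq T) :
  (w \in words L n) = (size w == n) && all (mem L) w.
Proof.
elim: n w => [|n IH] [|x w] //=.
  by apply/negbTE/allpairsP => -[[y v] [_ _]].
apply/allpairsP/idP => [[[y v] /= [yL vw [-> ->]]]|].
  by rewrite eqSS andbCA yL -IH.
rewrite eqSS andbCA => /andP[xL wn]; exists (x, w); split => //=.
by rewrite IH.
Qed.

(** * Edges of lattice paths and reduction to simple paths *)

Lemma adjacentP (z w : pt) : adjacent z w ->
  [\/ w = (z.1, z.2 + 1), w = (z.1, z.2 - 1),
      w = (z.1 + 1, z.2) | w = (z.1 - 1, z.2)].
Proof.
case: z w => x y [x' y']; rewrite /adjacent /=.
case/orP => /andP[/eqP <-] /orP[/eqP ->|/eqP ->].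
- by constructor 1.
- by constructor 2; rewrite addrK.
- by constructor 3.
- by constructor 4; rewrite addrK.
Qed.

Lemma edge_of_endpoint (x y a b : pt) : adjacent x y -> adjacent a b ->
  edge_of x y = edge_of a b -> x = a \/ x = b.
Proof.
case: x y a b => [x1 x2] [y1 y2] [a1 a2] [b1 b2].
rewrite /adjacent /edge_of /=; have pairE (u v u' v' : int) :
  u = u' -> v = v' -> (u, v) = (u', v') by move=> -> ->.
move=> H1 H2.
case: (eqVneq x1 y1) => e1; case: (eqVneq a1 b1) => e2 // [h1 h2];
  have [?|?] : (x1 = a1 /\ x2 = a2) \/ (x1 = b1 /\ x2 = b2) by lia.
all: by [left; apply: pairE; tauto | right; apply: pairE; tauto].
Qed.

(** If the first edge recurred, its starting point [z] would be an endpoint of a later edge and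
    hence be visited again. *)
Lemma uniq_path_edges (z : pt) (p : seq pt) :
  path adjacent z p -> uniq (z :: p) -> uniq (pairmap edge_of z p).
Proof.
elim: p z => [|y p IH] z //= /andP[zy yp] /and3P[zNp yNp up].
rewrite (IH y) ?andbT //=; last by rewrite yNp.
apply/negP => /(nthP (edge_of z z)) [i]; rewrite size_pairmap => ip e.
move: e; rewrite (nth_pairmap z) // => /esym e.
have ab : adjacent (nth z (y :: p) i) (nth z p i) by apply/(pathP z).
case: (edge_of_endpoint zy ab e) => h; case/negP: zNp; rewrite {1}h.
  by apply: mem_nth; rewrite /= ltnS ltnW.
by rewrite inE mem_nth ?orbT.
Qed.

(** Loops are erased in the graph whose only edges are those of [p], so no new edge can appear. *)
Lemma simple_subpath (z : pt) (p : seq pt) : path adjacent z p ->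
  exists q, [/\ path adjacent z q, last z q = last z p, uniq (z :: q)
    & {subset pairmap edge_of z q <= pairmap edge_of z p}].
Proof.
move=> zp; pose e := [rel x y | adjacent x y && (edge_of x y \in pairmap edge_of z p)].
have ep : path e z p.
  apply/(pathP z) => i ip /=; rewrite (pathP z zp) //=.
  by rewrite -(nth_pairmap z (edge_of z z)) // mem_nth // size_pairmap.
case: (shortenP ep) => q eq uq _; exists q; split => //.
  by apply: sub_path eq => x y /andP[].
move=> f /(nthP (edge_of z z)) [i]; rewrite size_pairmap => iq.
by rewrite (nth_pairmap z) // => <-; case/andP: (pathP z eq i iq).
Qed.

(** * Words extracted from lattice paths *)

(* A letter [(true, b)] is a step to the right, marked if [b]; a letter
   [(false, b)] is a step up if [b] and a step down otherwise. *)
Fixpoint marked_steps (x y : int) (w : seq (bool * bool)) : seq pt :=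
  match w with
  | [::] => [::]
  | (true, b) :: w' =>
      if b then (x, y) :: marked_steps (x + 1) y w' else marked_steps (x + 1) y w'
  | (false, b) :: w' => marked_steps x (if b then y + 1 else y - 1) w'
  end.

Lemma marked_steps_ge (x y : int) (w : seq (bool * bool)) :
  all (fun z => x <= z.1) (marked_steps x y w).
Proof.
elim: w x y => [|[[] []] w IH] x y //=; last first.
- by apply: sub_all (IH (x + 1) y) => z /=; lia.
by rewrite lexx; apply: sub_all (IH (x + 1) y) => z /=; lia.
Qed.

(** Marked edges lie in different columns. Distinctness is what makes independence applicable to
    them. *)
Lemma uniq_marked_steps (x y : int) (w : seq (bool * bool)) :
  uniq (marked_steps x y w).
Proof.
elim: w x y => [|[[] []] w IH] x y //=; rewrite IH andbT.
apply/negP => h; have /allP/(_ _ h) /= := marked_steps_ge (x + 1) y w.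
by lia.
Qed.

Lemma size_marked_steps (x y : int) (w : seq (bool * bool)) :
  size (marked_steps x y w) = count_mem (true, true) w.
Proof. by elim: w x y => [|[[] []] w IH] x y //=; rewrite IH. Qed.

(** Padding with steps up marks nothing new and truncation only drops marks, so all words can be
    brought to one length. *)
Lemma all_marked_steps_take_pad (a : pred pt) (N k : nat) (x y : int)
    (w : seq (bool * bool)) : all a (marked_steps x y w) ->
  all a (marked_steps x y (take N (w ++ nseq k (false, true)))).
Proof.
elim: w N x y => [|[[] []] w IH] N x y /=.
  by elim: k N y => [|k IHk] [|N] y //= _; exact: IHk.
all: case: N => [|N] //=; try exact: IH.
by move=> /andP[-> h]; exact: IH.
Qed.

(** If [w] is not cut, its [n] or more right letters include at most [n / 2] unmarked ones. If it is
    cut, the prefix has [N] letters, of which at most [N - n] are vertical and at most [n / 2]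
    unmarked. *)
Lemma half_marked_take_pad (w : seq (bool * bool)) (n N : nat) :
  (n <= count (fun l => l.1) w)%N -> ((count_mem (true, false) w).*2 <= n)%N ->
  (count (fun l => ~~ l.1) w + n <= N)%N ->
  (n <= (count_mem (true, true) (take N (w ++ nseq N (false, true)))).*2)%N.
Proof.
move=> nR bad short.
have count3 (v : seq (bool * bool)) : (count_mem (true, true) v +
    count_mem (true, false) v + count (fun l => ~~ l.1) v)%N = size v.
  by elim: v => [|[[] []] v /= <-] //=; rewrite ?add0n ?add1n ?addnS ?addSn.
have count2 : (count_mem (true, true) w + count_mem (true, false) w)%N =
    count (fun l => l.1) w.
  by elim: (w) => [|[[] []] v /= <-] //=; rewrite ?add0n ?add1n ?addnS ?addSn.
have [wN|wN] := leqP (size w) N.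
  have -> : take N (w ++ nseq N (false, true)) =
      w ++ take (N - size w) (nseq N (false, true)) by rewrite take_cat ltnNge wN.
  rewrite count_cat doubleD; apply: leq_trans (leq_addr _ _); lia.
rewrite takel_cat; last exact: ltnW.
have sub := take_subseq w N.
have := count3 (take N w); rewrite size_takel; last exact: ltnW.
have le1 : (count_mem (true, false) (take N w) <= count_mem (true, false) w)%N.
  exact: leq_count_subseq sub.
have le2 : (count (fun l => ~~ l.1) (take N w) <= count (fun l => ~~ l.1) w)%N.
  exact: leq_count_subseq sub.
by lia.
Qed.

(* Of the horizontal steps only those reaching a new maximal column [M] are
   kept: the word stays in the column [M], at the height of the path. *)
Fixpoint record_word (good : pred pt) (M : int) (z : pt) (p : seq pt) :
    seq (bool * bool) :=
  if p is z' :: p' then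
    if z.1 == z'.1 then (false, z'.2 == z.2 + 1) :: record_word good M z' p'
    else if M < z'.1 then (true, good z) :: record_word good z'.1 z' p'
    else record_word good M z' p'
  else [::].

(** The word is read from [(M, z.2)], which may differ from [z]. At a record step the path stands in
    column [M], so the two positions agree exactly when a mark is set. *)
Lemma all_marked_record_word (good : pred pt) (M : int) (z : pt) (p : seq pt) :
  path adjacent z p -> z.1 <= M ->
  all good (marked_steps M z.2 (record_word good M z p)).
Proof.
elim: p M z => [|z' p IH] M z //= /andP[/adjacentP zz' zp] zM.
case: ifPn => [/eqP e|ne] /=.
  have -> : (if z'.2 == z.2 + 1 then z.2 + 1 else z.2 - 1) = z'.2.
    case: zz' => ez'; rewrite ez' /= ?eqxx //.
    + by case: eqP => //; lia.
    + by move: e; rewrite ez' /=; lia.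
    + by move: e; rewrite ez' /=; lia.
  by apply: IH; rewrite -?e.
case: ifPn => [Mz'|].
  have ez' : z' = (z.1 + 1, z.2).
    by case: zz' => ez' //; move: ne Mz' zM; rewrite ez' /= ?eqxx //; lia.
  have eM : z.1 = M by move: Mz' zM; rewrite ez' /=; lia.
  have e1 : z'.1 = M + 1 by rewrite ez' -eM.
  have e2 : z'.2 = z.2 by rewrite ez'.
  have H : all good (marked_steps (M + 1) z.2 (record_word good z'.1 z' p)).
    by rewrite -e1 -e2; apply: IH.
  rewrite /=; case: ifPn => [gz|_] //=.
  by rewrite H andbT -eM -surjective_pairing.
rewrite -leNgt => z'M.
have <- : z'.2 = z.2 by case: zz' ne => -> /=; rewrite ?eqxx.
exact: IH.
Qed.

Lemma record_word_right (good : pred pt) (M : int) (z : pt) (p : seq pt) :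
  path adjacent z p -> z.1 <= M ->
  (last z p).1 <= M + (count (fun l => l.1) (record_word good M z p))%:Z.
Proof.
elim: p M z => [|z' p IH] M z /=; first by rewrite addr0.
move=> /andP[/adjacentP zz' zp] zM.
case: ifPn => [/eqP e|ne] /=; first by rewrite add0n; apply: IH; rewrite -?e.
case: ifPn => [Mz'|].
  have : z'.1 = M + 1 by case: zz' ne Mz' => -> /=; lia.
  move=> e; have := IH z'.1 z' zp (lexx _); rewrite /=; lia.
by rewrite -leNgt; apply: IH.
Qed.

Lemma record_word_vertical (good : pred pt) (M : int) (z : pt) (p : seq pt) :
  path adjacent z p ->
  (last z p).2 <= z.2 + (count (fun l => ~~ l.1) (record_word good M z p))%:Z.
Proof.
elim: p M z => [|z' p IH] M z /=; first by rewrite addr0.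
move=> /andP[/adjacentP zz' zp].
case: ifPn => [/eqP e|ne] /=.
  by have := IH M z' zp; case: zz' => ->; rewrite /=; lia.
have <- : z'.2 = z.2 by case: zz' ne => -> /=; rewrite ?eqxx.
by case: ifPn => _ /=; apply: IH.
Qed.

(** * Costs of walks, bounds on passage times, and the greedy path *)

Section Cost.
Context {R : realType}.

Definition walk_cost (tau : pt -> R) (z : pt) (p : seq pt) : R :=
  \sum_(e <- pairmap edge_of z p) edge_weight tau e.

Lemma walk_cost_cons (tau : pt -> R) (z z' : pt) (p : seq pt) :
  walk_cost tau z (z' :: p) =
  edge_weight tau (edge_of z z') + walk_cost tau z' p.
Proof. by rewrite /walk_cost /= big_cons. Qed.

(** Dropped steps have nonnegative weight. A record step crosses the edge labelled [z], which costs
    at least [t], and at least [t + e] when unmarked. *)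
Lemma record_word_cost (tau : pt -> R) (good : pred pt) (t e : R) (M : int)
    (z : pt) (p : seq pt) :
  0 <= t -> (forall y, t <= tau y) -> (forall y, ~~ good y -> t + e <= tau y) ->
  path adjacent z p -> z.1 <= M ->
  let w := record_word good M z p in
  (count (fun l => ~~ l.1) w)%:R + t * (count (fun l => l.1) w)%:R
   + e * (count_mem (true, false) w)%:R <= walk_cost tau z p.
Proof.
move=> t0 ht hg; elim: p M z => [|z' p IH] M z /=.
  by rewrite /walk_cost big_nil !mulr0 !addr0.
move=> /andP[/adjacentP zz' zp] zM; rewrite walk_cost_cons /edge_of.
case: ifPn => [/eqP e1|ne] /=.
  have := IH M z' zp; rewrite -e1 => /(_ zM).
  by rewrite !add0n -natr1 /edge_weight /=; lra.
have pos : 0 <= edge_weight tau (true, (Num.min z.1 z'.1, z.2)).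
  by rewrite /edge_weight /=; exact: le_trans (ht _).
case: ifPn => [Mz'|].
  have ez' : z' = (z.1 + 1, z.2).
    by case: zz' => ez' //; move: ne Mz' zM; rewrite ez' /= ?eqxx //; lia.
  have := IH z'.1 z' zp (lexx _).
  have -> : (Num.min z.1 z'.1, z.2) = z.
    by rewrite ez' /=; case: (z) => a b /=; congr pair; lia.
  rewrite /= !natrD /edge_weight /=.
  case: (boolP (good z)) => gz /=; first by have := ht z; lra.
  by have := hg z gz; lra.
rewrite -leNgt => z'M.
by have := IH M z' zp z'M; rewrite /=; lra.
Qed.

Lemma passage_time_path_cons (tau : pt -> R) (z : pt) (p : seq pt) :
  passage_time_path tau z (z :: p) =
  \sum_(f <- undup (pairmap edge_of z p)) edge_weight tau f.
Proof. by []. Qed.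

Lemma edge_weight_ge0 (tau : pt -> R) (e : bool * pt) :
  (forall y, 0 <= tau y) -> 0 <= edge_weight tau e.
Proof. by rewrite /edge_weight; case: ifP => // _; apply. Qed.

Lemma sum_undup_le (T : eqType) (F : T -> R) (s : seq T) :
  (forall x, 0 <= F x) -> \sum_(x <- undup s) F x <= \sum_(x <- s) F x.
Proof.
move=> F0; elim: s => [|x s IH] //=; case: ifP => xs; rewrite !big_cons ?lerD2l //.
by apply: le_trans IH _; rewrite lerDr.
Qed.

Lemma sum_subset_le (T : eqType) (F : T -> R) (s t : seq T) :
  (forall x, 0 <= F x) -> uniq s -> {subset s <= t} ->
  \sum_(x <- s) F x <= \sum_(x <- undup t) F x.
Proof.
move=> F0 us st.
rewrite [leRHS](bigID (mem s)) /= -[leLHS]addr0 lerD ?sumr_ge0 //.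
have ps : perm_eq s [seq x <- undup t | x \in s].
  apply: uniq_perm => [//||x]; first by rewrite filter_uniq ?undup_uniq.
  by rewrite mem_filter mem_undup andb_idr //; exact: st.
by rewrite (perm_big _ ps) big_filter.
Qed.

Lemma passage_time_le (tau : pt -> R) (z : pt) (p : seq pt) :
  (forall y, 0 <= tau y) -> path adjacent z p ->
  passage_time tau z (last z p) <= walk_cost tau z p.
Proof.
move=> t0 zp; apply: (@le_trans _ _ (passage_time_path tau z (z :: p))); last first.
  by apply: sum_undup_le => e; exact: edge_weight_ge0.
apply: ge_inf; last by exists (z :: p).
by exists 0 => _ [q _ <-]; apply: sumr_ge0 => e _; exact: edge_weight_ge0.
Qed.

Lemma up_path (tau : pt -> R) (z : pt) (k : nat) : exists p,
  [/\ path adjacent z p, last z p = (z.1, z.2 + k%:Z) & walk_cost tau z p = k%:R].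
Proof.
elim: k z => [|k IH] z.
  by exists [::]; rewrite addr0 /walk_cost big_nil; case: z.
have [p [h1 h2 h3]] := IH (z.1, z.2 + 1).
exists ((z.1, z.2 + 1) :: p); split => /=.
- by rewrite h1 andbT /adjacent /= !eqxx.
- by rewrite h2 /=; congr pair; lia.
- by rewrite walk_cost_cons h3 /edge_of /= eqxx /edge_weight /= -natr1 addrC.
Qed.

Lemma right_up_path (z : pt) (n k : nat) : exists p,
  path adjacent z p /\ last z p = (z.1 + n%:Z, z.2 + k%:Z).
Proof.
elim: n z => [|n IH] z.
  by have [p [h1 h2 _]] := up_path (fun=> 0) z k; exists p; rewrite addr0.
have [p [h1 h2]] := IH (z.1 + 1, z.2).
exists ((z.1 + 1, z.2) :: p); split => /=.
  by rewrite h1 andbT /adjacent /= !eqxx orbT.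
by rewrite h2 /=; congr pair; lia.
Qed.

(** A path nearly attaining the infimum is made simple. Then no edge repeats, and [walk_cost], which
    counts repetitions, is bounded by the passage time of the original path. *)
Lemma passage_time_lt_path (tau : pt -> R) (n k : nat) (C : R) :
  (forall y, 0 <= tau y) -> passage_time tau (0, 0) (n%:Z, k%:Z) < C ->
  exists p, [/\ path adjacent (0, 0) p, last (0, 0) p = (n%:Z, k%:Z)
    & walk_cost tau (0, 0) p < C].
Proof.
move=> t0 /inf_lt [|_ [[|z p] [//= ? h2 _ h4] <-] hC].
  have [p [h1 h2]] := right_up_path (0, 0) n k.
  have lp : lattice_path (0, 0) (n%:Z, k%:Z) ((0, 0) :: p).
    by split => //=; rewrite h2 /= !add0r.
  by exists (passage_time_path tau (0, 0) ((0, 0) :: p)), ((0, 0) :: p).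
subst z; have [q [q1 q2 q3 q4]] := simple_subpath h4.
exists q; split => //; first by rewrite q2.
apply: le_lt_trans hC; rewrite passage_time_path_cons.
apply: sum_subset_le => //; first by move=> e; exact: edge_weight_ge0.
exact: uniq_path_edges.
Qed.

Lemma passage_time_ge (tau : pt -> R) (t : R) (n k : nat) :
  0 <= t -> (forall y, t <= tau y) ->
  k%:R + t * n%:R <= passage_time tau (0, 0) (n%:Z, k%:Z).
Proof.
move=> t0 ht; rewrite leNgt; apply/negP => /passage_time_lt_path [].
  by move=> y; exact: le_trans (ht y).
move=> p [h1 h2]; apply/negP; rewrite -leNgt.
have := @record_word_cost tau xpredT t 0 0 (0, 0) p t0 ht (fun _ => ltac:(by [])) h1 (lexx _).
rewrite /= mul0r addr0; apply: le_trans.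
have := record_word_right xpredT h1 (lexx _).
have := record_word_vertical xpredT 0 h1.
rewrite h2 /= !add0r !lez_nat => v r.
by rewrite lerD ?ler_nat // ler_wpM2l ?ler_nat.
Qed.

(* [true] steps right across the edge at the current position, which must be
   good; [false] steps up past an edge that is not good. *)
Fixpoint greedy_word (good : pred pt) (N : nat) (x y : int) : seq bool :=
  if N is N'.+1 then
    if good (x, y) then true :: greedy_word good N' (x + 1) y
    else false :: greedy_word good N' x (y + 1)
  else [::].

Fixpoint skipped_edges (x y : int) (w : seq bool) : seq pt :=
  match w with
  | [::] => [::]
  | true :: w' => skipped_edges (x + 1) y w'
  | false :: w' => (x, y) :: skipped_edges x (y + 1) w'
  end.

Lemma skipped_edges_ge (x y : int) (w : seq bool) :
  all (fun z => y <= z.2) (skipped_edges x y w).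
Proof.
elim: w x y => [|[] w IH] x y //=; rewrite lexx.
by apply: sub_all (IH x (y + 1)) => z /=; lia.
Qed.

(** Each skip is followed by a step up, so skipped edges have different heights. *)
Lemma uniq_skipped_edges (x y : int) (w : seq bool) : uniq (skipped_edges x y w).
Proof.
elim: w x y => [|[] w IH] x y //=; rewrite IH andbT.
apply/negP => h; have /allP/(_ _ h) /= := skipped_edges_ge x (y + 1) w.
by lia.
Qed.

Lemma size_skipped_edges (x y : int) (w : seq bool) :
  size (skipped_edges x y w) = count_mem false w.
Proof. by elim: w x y => [|[] w IH] x y //=; rewrite IH. Qed.

Lemma size_greedy_word (good : pred pt) (N : nat) (x y : int) :
  size (greedy_word good N x y) = N.
Proof. by elim: N x y => [|N IH] x y //=; case: ifP => _ /=; rewrite IH. Qed.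

Lemma all_skipped_greedy (good : pred pt) (N : nat) (x y : int) :
  all (predC good) (skipped_edges x y (greedy_word good N x y)).
Proof. by elim: N x y => [|N IH] x y //=; case: ifPn => /= [_|->]; rewrite IH. Qed.

(** The greedy word is followed until [n] edges have been crossed; the rest of the height is climbed
    straight up. Since [N <= k], the target height is not overshot. *)
Lemma greedy_path (tau : pt -> R) (good : pred pt) (a : R) (N n k : nat) (x y : int) :
  (forall z, good z -> tau z <= a) ->
  (n <= count_mem true (greedy_word good N x y))%N -> (N <= k)%N ->
  exists p, [/\ path adjacent (x, y) p, last (x, y) p = (x + n%:Z, y + k%:Z)
    & walk_cost tau (x, y) p <= k%:R + a * n%:R].
Proof.
move=> ha; elim: N n k x y => [|N IH] [|n] k x y //= hn Nk.
1,2: by have [p [h1 h2 h3]] := up_path tau (x, y) k;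
  exists p; rewrite addr0 mulr0 addr0 h3.
move: hn; case: ifPn => [g|_] /=; rewrite ?add0n ?add1n ?ltnS => hn.
  have [p [h1 h2 h3]] := IH n k (x + 1) y hn (ltnW Nk).
  exists ((x + 1, y) :: p); split => /=.
  - by rewrite h1 andbT /adjacent /= !eqxx orbT.
  - by rewrite h2; congr pair; lia.
  - rewrite walk_cost_cons /edge_of /=; case: eqP => [|_]; first by lia.
    have -> : Num.min x (x + 1) = x by lia.
    by have := ha _ g; rewrite -natr1 /edge_weight /=; lra.
case: k Nk => // k Nk.
have [p [h1 h2 h3]] := IH n.+1 k x (y + 1) hn Nk.
exists ((x, y + 1) :: p); split => /=.
- by rewrite h1 andbT /adjacent /= !eqxx.
- by rewrite h2; congr pair; lia.
- rewrite walk_cost_cons /edge_of /= eqxx /edge_weight /=.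
  by rewrite -[k.+1%:R]natr1; lra.
Qed.

End Cost.

(** * Union bounds and the time constant *)

Section Probability.
Context {R : realType} {d : measure_display} {Omega : measurableType d}.
Context {P : probability Omega R} {G : probability R R}.
Context {tau : pt -> Omega -> R} (iid : iid_weights P G tau).

Definition all_in (A : set R) (s : seq pt) : set Omega :=
  \bigcap_(z in [set` s]) (tau z @^-1` A).

Lemma measurable_all_in (A : set R) (s : seq pt) :
  measurable A -> measurable (all_in A s).
Proof.
case: iid => mtau _ _ mA; apply: fin_bigcap_measurable => // z _.
by rewrite -[X in measurable X]setTI; exact: mtau.
Qed.

Lemma prob_all_in (A : set R) (s : seq pt) : measurable A -> uniq s ->
  P (all_in A s) = (fine (G A) ^+ size s)%:E.
Proof.
case: iid => mtau law indep mA us.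
rewrite -[LHS]fineK; last by apply: fin_num_measure; exact: measurable_all_in.
congr EFin; rewrite (indep s (fun=> A) us (fun=> mA)).
rewrite (eq_bigr (fun=> fine (G A))) => [|z _]; last by rewrite law.
by elim: s {us} => [|z s IH]; rewrite ?big_nil ?big_cons ?IH -?exprS.
Qed.

Definition word_event (T : Type) (mk : seq T -> seq pt) (A : set R)
    (ws : seq (seq T)) : set Omega :=
  \big[setU/set0]_(w <- ws) all_in A (mk w).

Lemma measurable_word_event (T : Type) (mk : seq T -> seq pt) (A : set R)
    (ws : seq (seq T)) : measurable A -> measurable (word_event mk A ws).
Proof. by move=> mA; apply: bigsetU_measurable => w _; exact: measurable_all_in. Qed.

Lemma word_eventP (T : eqType) (mk : seq T -> seq pt) (A : set R)
    (ws : seq (seq T)) (w : seq T) (o : Omega) :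
  w \in ws -> (forall z, z \in mk w -> A (tau z o)) -> word_event mk A ws o.
Proof.
move=> wws h; rewrite /word_event (big_rem w) //=; left => z /= zs; exact: h.
Qed.

Lemma prob_word_event (T : Type) (mk : seq T -> seq pt) (A : set R)
    (ws : seq (seq T)) : measurable A -> (forall w, uniq (mk w)) ->
  (P (word_event mk A ws) <= (\sum_(w <- ws) fine (G A) ^+ size (mk w))%:E)%E.
Proof.
move=> mA umk; rewrite /word_event; elim: ws => [|w ws IH].
  by rewrite !big_nil measure0.
rewrite !big_cons; apply: le_trans (measureU2 _ _ _) _.
- exact: measurable_all_in.
- exact: measurable_word_event.
rewrite EFinD; apply: leeD => //.
by rewrite le_eqVlt; apply/orP; left; apply/eqP; exact: prob_all_in.
Qed.

(** An exponential-weight form of the union bound: once each word is dominated by a product over its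
    letters, the sum may be extended to all words, where it factorizes. *)
Lemma prob_word_event_le (T : eqType) (L : seq T) (N : nat) (Q : pred (seq T))
    (mk : seq T -> seq pt) (A : set R) (f : T -> R) (c : R) :
  measurable A -> (forall w, uniq (mk w)) -> 0 <= c -> (forall x, 0 <= f x) ->
  (forall w, size w = N -> Q w ->
    fine (G A) ^+ size (mk w) <= c * \prod_(x <- w) f x) ->
  (P (word_event mk A [seq w <- words L N | Q w])
    <= (c * (\sum_(x <- L) f x) ^+ N)%:E)%E.
Proof.
move=> mA umk c0 f0 h; apply: le_trans (prob_word_event _ mA umk) _.
rewrite lee_fin big_filter -sum_words_prod mulr_sumr.
rewrite big_seq_cond [leRHS]big_seq.
rewrite [leRHS](bigID Q) /= -[leLHS]addr0 lerD //.
  by apply: ler_sum => w /andP[]; rewrite mem_words => /andP[/eqP ? _] ?; exact: h.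
by apply: sumr_ge0 => w _; rewrite mulr_ge0 // prodr_ge0.
Qed.

Lemma expr_lt_near (x e : R) : 0 <= x < 1 -> 0 < e ->
  \forall n \near \oo, x ^+ n < e.
Proof.
move=> /andP[x0 x1] e0; apply: cvgr_lt e0.
by apply: cvg_expr; rewrite ger0_norm.
Qed.

(** A tail intersection lies in every later [F n] and is therefore null; countably many null sets
    cannot cover almost all of the space. The two probabilistic bounds on [Lambda] are proved by
    contradiction with this. *)
Lemma not_ae_eventually (F : nat -> set Omega) :
  (forall n, measurable (F n)) -> (forall n, (P (F n) <= (2^-1 ^+ n)%:E)%E) ->
  ~ {ae P, forall o, \forall n \near \oo, F n o}.
Proof.
move=> mF PF /= aeF.
pose I N := \bigcap_(n in [set n | (N <= n)%N]) F n.
have mI N : measurable (I N).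
  by apply: bigcap_measurable => //; exists N => /=.
have PI N : P (I N) = 0%E.
  have fI : P (I N) \is a fin_num by exact: fin_num_measure.
  apply/eqP; rewrite eq_le measure_ge0 andbT -(fineK fI) lee_fin leNgt.
  apply/negP => /(expr_lt_near (x := 2^-1)) => /(_ ltac:(apply/andP; split; lra)).
  move=> [M _ /(_ (maxn N M))] /= /(_ (leq_maxr _ _)); apply/negP; rewrite -leNgt.
  rewrite -lee_fin fineK //; apply: le_trans (PF (maxn N M)).
  apply: le_measure; rewrite ?inE //.
  by move=> o; apply; exact: leq_maxl.
have negT : P.-negligible setT.
  apply: (negligibleS (A := ~` [set o | \forall n \near \oo, F n o] `|` \bigcup_N I N)).
    move=> o _; case: (pselect (\forall n \near \oo, F n o)) => h; last by left.
    right; case: h => N _ h; exists N => // n; exact: h.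
  apply: negligibleU => //; apply: negligible_bigcup => N.
  by apply/negligibleP; [exact: mI|exact: PI].
have : P setT = 0%E by apply/negligibleP.
by rewrite probability_setT => /eqP; rewrite onee_eq0.
Qed.

Lemma not_ae_false : ~ {ae P, forall o, False}.
Proof.
move=> h; apply: (not_ae_eventually (F := fun=> set0)) => //.
  by move=> n; rewrite measure0 lee_fin.
by apply: filterS h.
Qed.

(** There are countably many edges; [unpickle] enumerates them. *)
Lemma ae_all_tau (t : R) : G `]-oo, t[%classic = 0%E -> {ae P, forall o, forall z, t <= tau z o}.
Proof.
case: iid => mtau law _ G0.
have H (n : nat) : {ae P, forall o, forall z, unpickle n = Some z -> t <= tau z o}.
  case: (unpickle n) => [z|]; last exact: aeW.
  apply: (@filterS _ _ _ [set o | t <= tau z o]) => [x h z' [<-] //|].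
  exists (tau z @^-1` `]-oo, t[%classic); split.
  - by rewrite -[X in measurable X]setTI; exact: mtau.
  - by rewrite law.
  - by move=> o /= /negP; rewrite -ltNge in_itv.
move/ae_foralln: H; apply: filterS => o h z.
by apply: h (pickleK z).
Qed.

Context {Lambda : R -> R} (tc : is_time_constant P tau Lambda).

Lemma ceil_natE (v : R) (n : nat) : 0 <= v ->
  exists k : nat, [/\ Num.ceil (v * n%:R) = k%:Z, v * n%:R <= k%:R
    & k%:R < v * n%:R + 1].
Proof.
move=> v0; have vn : 0 <= v * n%:R by rewrite mulr_ge0.
exists `|Num.ceil (v * n%:R)|%N.
have e : Num.ceil (v * n%:R) = `|Num.ceil (v * n%:R)|%N%:Z.
  by rewrite gez0_abs // ceil_ge0; lra.
split => //.
  by rewrite -[leRHS]/(`|Num.ceil (v * n%:R)|%N%:Z%:~R) -e ceil_ge.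
rewrite -[ltLHS]/(`|Num.ceil (v * n%:R)|%N%:Z%:~R) -e.
by have := gt_pred_ceil (v * n%:R); rewrite intrB; lra.
Qed.

Lemma time_constant_ge (t u : R) : 0 <= t -> G `]-oo, t[%classic = 0%E -> 0 <= u ->
  u + t <= Lambda u.
Proof.
move=> t0 Gt u0; rewrite leNgt; apply/negP => lt.
apply: not_ae_false; apply: filterS2 (tc u0) (ae_all_tau Gt) => o cv ht.
have [N _ /(_ N.+1)] := cvgr_lt _ cv _ lt.
move=> /(_ (leqnSn N)) /=; apply/negP; rewrite -leNgt.
have [k [-> h1 h2]] := ceil_natE N.+1 u0.
rewrite ler_pdivlMr ?ltr0n //; apply: le_trans (passage_time_ge _ _ t0 ht).
by rewrite mulrDl lerD2r.
Qed.

Lemma time_constant_le (A : set R) (a : R) :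
  G `]-oo, 0[%classic = 0%E -> measurable A -> (forall x, A x -> x <= a) -> (0 < G A)%E ->
  exists K : nat, forall v, K%:R <= v -> Lambda v <= v + a.
Proof.
move=> G0 mA Aa GA.
have fA : G A \is a fin_num by exact: fin_num_measure.
(* A crossing gets weight [s] below its probability [p], a skip its probability [q], so that
   [s + q < 1]. *)
pose p := fine (G A); pose s := p / 2; pose q := fine (G (~` A)).
have p0 : 0 < p by rewrite -lte_fin fineK.
have pq : q = 1 - p.
  by rewrite /q probability_setC // /p -(fineK fA).
have q0 : 0 <= q by rewrite fine_ge0.
have s0 : 0 < s by rewrite /s; lra.
have sq : 0 <= s + q < 1 by apply/andP; split; rewrite /s; lra.
(* [(s + q) ^+ K < s / 2] makes the final bound [s ^- n * (s + q) ^+ (K * n)] at most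
   [2^-1 ^+ n]. *)
have [K _ /(_ K (leqnn K)) /= hK] := expr_lt_near sq (divr_gt0 s0 (ltr0Sn R 1)).
exists K => v Kv; have v0 : 0 <= v by exact: le_trans Kv.
rewrite leNgt; apply/negP => lt.
pose F n := word_event (skipped_edges 0 0) (~` A)
  [seq w <- words [:: true; false] (K * n) | (count_mem true w < n)%N].
apply: (@not_ae_eventually F).
- by move=> n; apply: measurable_word_event; exact: measurableC.
- move=> n; pose f (b : bool) := if b then s else q.
  have := @prob_word_event_le _ [:: true; false] (K * n)
    (fun w => count_mem true w < n)%N (skipped_edges 0 0) (~` A) f (s ^- n)
    (measurableC mA) (uniq_skipped_edges 0 0).
  move=> /(_ _ _ _)/le_trans; apply.
  + by rewrite invr_ge0 exprn_ge0 // ltW.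
  + by case; rewrite /f // ltW.
  + move=> w _ wn; rewrite size_skipped_edges -/q.
    (* With fewer than [n] crossings and [s <= 1], the factor [s ^- n] outweighs the crossing
       weights. *)
    have -> : \prod_(x <- w) f x = s ^+ count_mem true w * q ^+ count_mem false w.
      elim: w {wn} => [|[] w IH]; rewrite ?big_nil ?mulr1 // big_cons IH /f /= ?add0n add1n exprS.
        by rewrite mulrA.
      by rewrite mulrCA.
    rewrite mulrA ler_peMl ?exprn_ge0 // mulrC ler_pdivlMr ?exprn_gt0 // mul1r.
    apply: ler_wiXn2l; [exact: ltW| by rewrite /s; lra | exact: ltnW].
  + rewrite big_cons big_seq1 /f lee_fin exprM -exprVn -exprMn.
    have sK : 0 <= s^-1 * (s + q) ^+ K.
      by rewrite mulr_ge0 ?exprn_ge0 ?invr_ge0 ?(ltW s0) //; case/andP: sq.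
    apply: lerXn2r; rewrite ?nnegrE //.
    by rewrite mulrC ler_pdivrMr // mulrC ltW.
apply: filterS2 (tc v0) (ae_all_tau G0) => o cv ht.
(* Half of the supposed excess; for large [n], [e * n] absorbs the rounding error of the ceiling,
   which is below 1. *)
pose e := (Lambda v - (v + a)) / 2.
have e0 : 0 < e by rewrite /e; lra.
have lt' : v + a + e < Lambda v by rewrite /e; lra.
near=> n.
pose good z := `[< A (tau z o) >].
pose W := greedy_word good (K * n) 0 0.
(* With [n] crossings the greedy path is too cheap for the supposed limit; otherwise the greedy word
   itself witnesses [F n]. *)
have [cW|cW] := ltnP (count_mem true W) n; last first.
  exfalso; have : v + a + e < passage_time (tau ^~ o) (0, 0) (n%:Z, Num.ceil (v * n%:R)) / n%:R.
    by near: n; exact: cvgr_gt _ cv _ lt'.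
  apply/negP; rewrite -leNgt.
  have n0 : (0 < n)%N by near: n; exact: nbhs_infty_gt.
  have ne : 1 / e <= n%:R by near: n; exact: nbhs_infty_ger.
  have [k [-> h1 h2]] := ceil_natE n v0.
  have Kk : (K * n <= k)%N.
    by rewrite -(ler_nat R) natrM; apply: le_trans h1; rewrite ler_wpM2r.
  have good_le z : good z -> tau z o <= a by move=> /asboolP; exact: Aa.
  have [p' [h3 h4 h5]] := @greedy_path R (tau ^~ o) good a _ _ _ _ _ good_le cW Kk.
  rewrite ler_pdivrMr ?ltr0n //.
  have := passage_time_le ht h3; rewrite h4 !add0r => h6.
  have : 1 <= e * n%:R by rewrite mulrC -ler_pdivrMr.
  by lra.
apply: (@word_eventP _ _ _ _ W).
  rewrite mem_filter cW mem_words size_greedy_word eqxx /=.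
  by apply/allP => -[].
move=> z zW; have /allP/(_ _ zW) := all_skipped_greedy good (K * n) 0 0.
by move=> /= /asboolP.
Unshelve. all: by end_near.
Qed.

Lemma time_constant_gt (t u : R) : 0 <= t -> G `]-oo, t[%classic = 0%E ->
  (forall eta : R, 0 < eta -> exists2 e : R, 0 < e & (G `]-oo, (t + e)%R]%classic <= eta%:E)%E) ->
  0 <= u -> u + t < Lambda u.
Proof.
move=> t0 Gt small u0; rewrite ltNge; apply/negP => le.
(* A cheap path has at most [(u + e / 2) * n] vertical steps; with [n] more letters and [e <= 1]
   this fits into [K * n]. *)
have [K uK] : exists K : nat, u + 2 <= K%:R.
  exists (Num.truncn u).+3; have := truncnS_gt u.
  by rewrite -!natr1; lra.
have K4 : 1 <= 4 ^+ K :> R by rewrite exprn_ege1 // ler1n.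
(* The [4 ^+ (K * n)] words, each of probability at most [r ^+ n], contribute [2^-1 ^+ n]. Only half
   of the columns are known to be good, so the mass of [A] must be at most [r ^+ 2]. *)
pose r : R := (2 * 4 ^+ K)^-1.
have r0 : 0 < r by rewrite invr_gt0; lra.
have r1 : r <= 1 by rewrite invf_le1; lra.
have [e' e'0 He'] := small (r ^+ 2) (exprn_gt0 _ r0).
pose e := Num.min e' 1.
have e0 : 0 < e by rewrite lt_min e'0 ltr01.
have e1 : e <= 1 by rewrite ge_min lexx orbT.
pose A := `]-oo, (t + e)%R]%classic : set R.
have mA : measurable A by exact: measurable_itv.
have fA : G A \is a fin_num by exact: fin_num_measure.
have GA : fine (G A) <= r ^+ 2.
  rewrite -lee_fin fineK //; apply: le_trans He'; apply: le_measure; rewrite ?inE //.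
  by move=> x; rewrite /A /= !in_itv /= => /le_trans; apply; rewrite lerD2l ge_min lexx.
pose F n := word_event (marked_steps 0 0) A
  [seq w <- words [:: (true, true); (true, false); (false, true); (false, false)] (K * n)
    | (n <= (count_mem (true, true) w).*2)%N].
apply: (@not_ae_eventually F).
- by move=> n; apply: measurable_word_event.
- move=> n.
  have := @prob_word_event_le _
    [:: (true, true); (true, false); (false, true); (false, false)] (K * n)
    (fun w => n <= (count_mem (true, true) w).*2)%N (marked_steps 0 0) A (fun=> 1) (r ^+ n)
    mA (uniq_marked_steps 0 0).
  move=> /(_ _ _ _)/le_trans; apply.
  + by rewrite exprn_ge0 // ltW.
  + by [].
  + move=> w _ wn; rewrite size_marked_steps big1 // mulr1.
    apply: (@le_trans _ _ ((r ^+ 2) ^+ count_mem (true, true) w)).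
      by apply: lerXn2r; rewrite ?nnegrE ?fine_ge0 ?exprn_ge0 // ltW.
    by rewrite -exprM mul2n; apply: ler_wiXn2l => //; exact: ltW.
  + rewrite !big_cons big_nil lee_fin exprM -exprMn.
    have -> : 1 + (1 + (1 + (1 + 0))) = 4 :> R by lra.
    by rewrite /r invfM -mulrA mulVf ?mulr1 // gt_eqF //; lra.
apply: filterS2 (tc u0) (ae_all_tau Gt) => o cv ht.
have lt : Lambda u < u + t + e / 2 by lra.
near=> n.
have : passage_time (tau ^~ o) (0, 0) (n%:Z, Num.ceil (u * n%:R)) / n%:R < u + t + e / 2.
  by near: n; exact: cvgr_lt _ cv _ lt.
have n0 : (0 < n)%N by near: n; exact: nbhs_infty_gt.
have [k [-> h1 h2]] := ceil_natE n u0.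
rewrite ltr_pdivrMr ?ltr0n // => /passage_time_lt_path [|p [p1 p2 p3]].
  by move=> z; exact: le_trans (ht z).
pose good z := tau z o <= t + e.
have bad z : ~~ good z -> t + e <= tau z o by rewrite -ltNge => /ltW.
pose w := record_word good 0 (0, 0) p.
have := @record_word_cost R (tau ^~ o) good t e 0 (0, 0) p t0 ht bad p1 (lexx _).
rewrite -/w /= => cost.
have := record_word_right good p1 (lexx _); rewrite p2 /= add0r lez_nat -/w => wr.
have := record_word_vertical good 0 p1; rewrite p2 /= add0r lez_nat -/w => wv.
have gw := all_marked_record_word good p1 (lexx _); rewrite -/w /= in gw.
pose W := take (K * n) (w ++ nseq (K * n) (false, true)).
have sW : size W = (K * n)%N.
  by rewrite size_takel // size_cat size_nseq leq_addl.
apply: (@word_eventP _ _ _ _ W); last first.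
  move=> z zW; have /allP/(_ _ zW) := all_marked_steps_take_pad (K * n) (K * n) gw.
  by rewrite /good /A /= in_itv.
rewrite mem_filter mem_words sW eqxx /= andbC; apply/andP; split.
  by apply/allP => -[[] []].
have t_n : t * n%:R <= t * (count (fun l => l.1) w)%:R by rewrite ler_wpM2l ?ler_nat.
have kv : k%:R <= (count (fun l => ~~ l.1) w)%:R :> R by rewrite ler_nat.
(* Vertical steps cost at least [u * n] and record steps at least [t * n], which leaves less than
   [e * n / 2] for the surcharges [e]. *)
have few_bad : ((count_mem (true, false) w).*2 <= n)%N.
  rewrite -(ler_nat R) -muln2 natrM -(ler_pM2l e0); lra.
have short : (count (fun l => ~~ l.1) w + n <= K * n)%N.
  rewrite -(ler_nat R) natrD natrM.
  have : 0 <= e * (count_mem (true, false) w)%:R by rewrite mulr_ge0 // ltW.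
  have : (u + 2) * n%:R <= K%:R * n%:R by rewrite ler_wpM2r.
  have : e * n%:R <= 1 * n%:R by rewrite ler_wpM2r.
  have : 0 <= n%:R :> R by [].
  lra.
by rewrite /W; exact: half_marked_take_pad.
Unshelve. all: by end_near.
Qed.

End Probability.

(** * Mass of [G] near its essential infimum *)

Section EssentialInfimum.
Context {R : realType} (G : probability R R).
Context (G_nonneg : G `[0, +oo[%classic = 1%E).

Let t0 := inf [set x : R | (0 < G `[0%R, x]%classic)%E].

Lemma negative_null : G `]-oo, 0[%classic = 0%E.
Proof.
have -> : `]-oo, 0[%classic = ~` `[0, +oo[%classic :> set R.
  by apply/seteqP; split => x /=; rewrite !in_itv /= andbT ltNge => /negP.
by rewrite probability_setC ?G_nonneg ?subee.
Qed.

Lemma segment_mass_ge0 (x : R) : (0 < G `[0%R, x]%classic)%E -> 0 <= x.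
Proof.
rewrite leNgt => Gx; apply/negP => x0; move: Gx.
by rewrite set_itv_ge ?measure0 ?ltxx // bnd_simp -ltNge.
Qed.

Lemma segment_mass_nonempty : [set x : R | (0 < G `[0%R, x]%classic)%E] !=set0.
Proof.
apply/set0P/negP => /eqP S0.
have neg : G.-negligible `[0, +oo[%classic.
  apply: (negligibleS (A := \bigcup_n `[0%R, (n%:R : R)]%classic)).
    move=> x; rewrite /= in_itv /= andbT => x0.
    exists (Num.truncn x).+1 => //=; rewrite in_itv /= x0 /=.
    by rewrite ltW // truncnS_gt.
  apply: negligible_bigcup => n; apply/negligibleP => //.
  apply/eqP; rewrite eq_le measure_ge0 andbT leNgt; apply/negP => Gn.
  by have : set0 (n%:R : R) by rewrite -S0.
have : G `[0, +oo[%classic = 0%E by apply/negligibleP.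
by rewrite G_nonneg => /eqP; rewrite onee_eq0.
Qed.

Lemma essinf_ge0 : 0 <= t0.
Proof.
apply: lb_le_inf; first exact: segment_mass_nonempty.
by move=> x; exact: segment_mass_ge0.
Qed.

(** The half-line is covered by the negative numbers and the segments up to [t0 - 1 / (n + 1)], each
    null because its right end is below the infimum. *)
Lemma lt_essinf_null : G `]-oo, t0[%classic = 0%E.
Proof.
apply/negligibleP => //.
apply: (negligibleS (A := `]-oo, 0[%classic `|`
    \bigcup_n `[0%R, t0 - n.+1%:R^-1]%classic)).
  move=> x; rewrite /= in_itv /= => xt.
  have [x0|x0] := ltP x 0; [by left; rewrite /= in_itv|right].
  have [n hn] : exists n : nat, n.+1%:R^-1 < t0 - x.
    have tx : 0 < t0 - x by rewrite subr_gt0.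
    exists (Num.truncn (t0 - x)^-1).
    rewrite -[ltRHS]invrK ltf_pV2 ?posrE ?ltr0n ?invr_gt0 //; exact: truncnS_gt.
  by exists n => //=; rewrite in_itv /= x0 /= lerBrDr addrC -lerBrDr ltW.
apply: negligibleU; first by apply/negligibleP => //; exact: negative_null.
apply: negligible_bigcup => n; apply/negligibleP => //.
apply/eqP; rewrite eq_le measure_ge0 andbT leNgt; apply/negP => Gn.
have : t0 <= t0 - n.+1%:R^-1.
  by apply: ge_inf => //; exists 0 => x; exact: segment_mass_ge0.
by rewrite leNgt gtrBl invr_gt0 ltr0Sn.
Qed.

Lemma gt_essinf_mass (e : R) : 0 < e -> (0 < G `]-oo, (t0 + e)%R]%classic)%E.
Proof.
move=> e0; have : t0 < t0 + e by rewrite ltrDl.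
move=> /(inf_lt segment_mass_nonempty) [y Gy yt].
apply: lt_le_trans Gy _; apply: le_measure; rewrite ?inE //.
by move=> x /=; rewrite !in_itv /= => /andP[_ /le_trans]; apply; exact: ltW.
Qed.

(** Continuity from above along [t0 + 1 / (n + 1)]: the intersection of the half-lines is null when
    [t0] is not an atom. *)
Lemma near_essinf_small (eta : R) : G [set t0] = 0%E -> 0 < eta ->
  exists2 e : R, 0 < e & (G `]-oo, (t0 + e)%R]%classic <= eta%:E)%E.
Proof.
move=> Gt eta0; pose F n := `]-oo, (t0 + n.+1%:R^-1)%R]%classic : set R.
have FI : \bigcap_n F n = `]-oo, t0]%classic.
  apply/seteqP; split => x /=; last first.
    move=> xt n _; move: xt; rewrite /F /= !in_itv /= => /le_trans; apply.
    by rewrite lerDl invr_ge0.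
  move=> h; rewrite in_itv /= leNgt; apply/negP => xt.
  have tx : 0 < x - t0 by rewrite subr_gt0.
  have := h (Num.truncn (x - t0)^-1) I; rewrite /F /= in_itv /=.
  apply/negP; rewrite -ltNge -ltrBrDl.
  rewrite -[ltRHS]invrK ltf_pV2 ?posrE ?ltr0n ?invr_gt0 //; exact: truncnS_gt.
have G0 : G (\bigcap_n F n) = 0%E.
  rewrite FI; apply/negligibleP => //.
  apply: (negligibleS (A := `]-oo, t0[%classic `|` [set t0])).
    move=> x; rewrite /= !in_itv /= le_eqVlt => /orP[/eqP ->|]; [by right|by left].
  apply: negligibleU; apply/negligibleP => //; exact: lt_essinf_null.
have mF n : measurable (F n) by exact: measurable_itv.
have nF : {homo F : n m / (n <= m)%N >-> (m <= n)%O}.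
  move=> n m nm; apply/subsetPset => x; rewrite /F /= !in_itv /= => /le_trans; apply.
  by rewrite lerD2l lef_pV2 ?posrE ?ltr0n // ler_nat ltnS.
have F0 : (G (F 0%N) < +oo)%E by rewrite ltey_eq fin_num_measure.
have mFI : measurable (\bigcap_n F n) by rewrite FI.
have cv : (G \o F) n @[n --> \oo] --> (0%E : \bar R).
  by rewrite -G0; exact: nonincreasing_cvg_mu.
have nb : nbhs (0%E : \bar R) [set y | (y < eta%:E)%E].
  apply: open_nbhs_nbhs; split; first exact: open_ereal_lt_ereal.
  by rewrite /= lte_fin.
have [n _ /(_ n (leqnn n)) /= h] := cv _ nb.
by exists n.+1%:R^-1; [rewrite invr_gt0|exact: ltW].
Qed.

End EssentialInfimum.

(** * Flat edges *)

Section Shape.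
Context {R : realType} (Lambda : R -> R).

(** The substitution [v = tan theta] turns polar into Cartesian coordinates; [theta = pi / 2] gives
    the points [(0, s2)]. *)
Lemma shape_boundaryP (z : R * R) : shape_boundary Lambda z <->
  exists s1 s2 : R, [/\ s1 = 1 \/ s1 = -1, s2 = 1 \/ s2 = -1 &
    z = (0, s2) \/ exists2 v, 0 <= v & z = (s1 / Lambda v, s2 * v / Lambda v)].
Proof.
have pi0 := pi_gt0 R; split.
  move=> [th [/andP[th0 th1] [s1 [s2 [h1 [h2 ->]]]]]]; exists s1, s2; split => //.
  rewrite /shape_radius; case: eqP => [->|/eqP ne].
    by left; rewrite cos_pihalf sin_pihalf !mulr0 !mulr1.
  right; have lt : th < pi / 2 by rewrite lt_neqAle ne.
  have c0 : 0 < cos th by apply: cos_gt0_pihalf; rewrite lt andbT; lra.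
  have s0 : 0 <= sin th by apply: sin_ge0_pi; rewrite th0 /=; lra.
  exists (tan th); first by rewrite /tan divr_ge0 // ltW.
  rewrite invfM; congr pair; last by rewrite /tan; ring.
  by rewrite -mulrA mulVf ?gt_eqF // mulr1.
move=> [s1 [s2 [h1 h2 [->|[v v0 ->]]]]].
  exists (pi / 2); split; first by apply/andP; split; lra.
  exists s1, s2; split => //; split => //.
  by rewrite /shape_radius eqxx cos_pihalf sin_pihalf !mulr0 !mulr1.
have c0 : 0 < cos (atan v) by apply: cos_gt0_pihalf; rewrite atan_gtNpi2 atan_ltpi2.
exists (atan v); split.
  rewrite (ltW (atan_ltpi2 v)) andbT leNgt; apply/negP => a0.
  have sv : sin (atan v) = v * cos (atan v).
    by rewrite -{2}(atanK v) /tan divfK // gt_eqF.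
  have : 0 < sin (- atan v).
    by apply: sin_gt0_pi; have := atan_gtNpi2 v; lra.
  by rewrite sinN sv oppr_gt0 ltNge mulr_ge0 // ltW.
exists s1, s2; split => //; split => //.
rewrite /shape_radius lt_eqF ?atan_ltpi2 // atanK invfM.
congr pair; first by rewrite -mulrA mulVf ?gt_eqF // mulr1.
by rewrite -{1}(atanK v) /tan; ring.
Qed.

Lemma flat_edge_affine : (forall u, 0 <= u -> 0 < Lambda u) ->
  on_flat_edge (shape_boundary Lambda) (0, 1) ->
  exists c u0 : R, 0 <= u0 /\ forall u, u0 <= u -> Lambda u = u + c.
Proof.
move=> L0 [_ [y [/shape_boundaryP [s1 [s2 [h1 h2 hy]]] [yx yB]]]].
case: hy => [ey|[v v0 ey]].
  have s2E : s2 = -1 by case: h2 => // e; case: yx; rewrite ey e.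
  (* If [y] is [(0, -1)], the segment leaves the boundary, whose only points on the vertical axis
     are [(0, 1)] and [(0, -1)]. *)
  have : segment (0, 1) y (0, 2^-1).
    exists 4^-1; split; first by apply/andP; split; lra.
    by rewrite ey s2E /=; congr pair; field.
  move=> /yB /shape_boundaryP [r1 [r2 [k1 k2 [[e]|[u u0 [e _]]]]]].
    by exfalso; case: k2 e => ->; lra.
  have : (Lambda u)^-1 != 0 by rewrite invr_neq0 // gt_eqF // L0.
  by move=> /eqP; case; case: k1 e => ->; lra.
(* The line through [(0, 1)] and [y] consists of the points with second coordinate [1 - c * s1]
   times the first. Beyond [v + 1] one has [Lambda v < u + c], so the point of slope [s1 * u] lies
   between [(0, 1)] and [y]. *)
exists (Lambda v - s2 * v), (v + 1); split; first lra.
move=> u vu; have Lv := L0 v v0.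
have c1 : Lambda v < u + (Lambda v - s2 * v) by case: h2 => ->; lra.
set c := Lambda v - s2 * v in c1 *.
have uc : 0 < u + c by lra.
have : segment (0, 1) y (s1 / (u + c), u / (u + c)).
  exists (Lambda v / (u + c)); split.
    by rewrite divr_ge0 ?ler_pdivrMr ?mul1r //; lra.
  have uc' : u + c != 0 by rewrite gt_eqF.
  have Lv' : Lambda v != 0 by rewrite gt_eqF.
  rewrite ey /=; congr pair; first by field; rewrite Lv' uc'.
  apply: (mulIf uc'); rewrite divfK // mulr1 mulrDl mulrBl mul1r divfK //.
  have -> : Lambda v / (u + c) * (s2 * v / Lambda v) * (u + c) = s2 * v.
    by field; rewrite Lv' uc'.
  by rewrite /c; ring.
move=> /yB /shape_boundaryP [r1 [r2 [k1 k2 [[e _]|[u' u'0 [e1 e2]]]]]].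
  have : (u + c)^-1 != 0 by rewrite invr_neq0 // gt_eqF.
  by move=> /eqP; case; case: h1 e => ->; lra.
have L' := L0 u' u'0.
have i1 : 0 < (u + c)^-1 by rewrite invr_gt0.
have i2 : 0 < (Lambda u')^-1 by rewrite invr_gt0.
(* First coordinates agree up to sign and both denominators are positive; then the second
   coordinates force [u' = u]. *)
have eL : Lambda u' = u + c.
  apply: invr_inj.
  by case: h1 e1 => ->; case: k1 => ->; lra.
rewrite -eL in e2 *; congr Lambda.
have : u = r2 * u' by apply: (mulIf (lt0r_neq0 i2)).
by case: k2 => ->; lra.
Qed.

Lemma affine_flat_edge (c u0 : R) : 0 < u0 -> 0 <= c ->
  (forall u, u0 <= u -> Lambda u = u + c) ->
  on_flat_edge (shape_boundary Lambda) (0, 1).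
Proof.
move=> p0 c0 h.
have B01 : shape_boundary Lambda (0, 1).
  by apply/shape_boundaryP; exists 1, 1; split; left.
split => //; exists (1 / Lambda u0, 1 * u0 / Lambda u0); split.
  apply/shape_boundaryP; exists 1, 1; split; [by left|by left|right].
  by exists u0 => //; exact: ltW.
have L0 : 0 < u0 + c by lra.
rewrite h //; split.
  by move=> [/eqP]; rewrite mul1r invr_eq0 gt_eqF.
move=> _ [t [/andP[t0 t1] ->]] /=.
move: t0; rewrite le_eqVlt => /orP[/eqP <-|t0].
  by rewrite !mul0r subr0 !mul1r !addr0.
apply/shape_boundaryP; exists 1, 1; split; [by left|by left|right].
have le : u0 + c <= (u0 + c) / t.
  by rewrite ler_pdivlMr // ler_piMr // ltW.
(* The slope [u] at parameter [t] solves [t / (u0 + c) = 1 / (u + c)]; it is at least [u0] because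
   [t <= 1]. *)
exists ((u0 + c) / t - c); first lra.
rewrite h; last lra.
by rewrite subrK; congr pair; field; rewrite ?gt_eqF.
Qed.

End Shape.

Theorem mainTheorem1 (R : realType) (G : probability R R)
  (d : measure_display) (Omega : measurableType d) (P : probability Omega R)
  (tau : pt -> Omega -> R) (Lambda : R -> R) :
  G `[0%R, +oo[%classic = 1%E ->
  (exists A : set R, measurable A /\ G A <> \d_(0%R : R) A) ->
  iid_weights P G tau ->
  is_time_constant P tau Lambda ->
  let t0 := inf [set x : R | (0 < G `[0%R, x]%classic)%E] in
  on_flat_edge (shape_boundary Lambda) (0, 1) <-> (0 < G [set t0])%E.
Proof.
move=> G1 _ iid tc t0.
have t0_ge0 : 0 <= t0 := essinf_ge0 G1.
have lt_null : G `]-oo, t0[%classic = 0%E := lt_essinf_null G1.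
have neg_null := negative_null G1.
split=> [flat|atom].
  rewrite lt0e measure_ge0 andbT; apply/eqP => no_atom.
  have strict u := time_constant_gt iid tc t0_ge0 lt_null
    (fun eta => near_essinf_small G1 no_atom) (u := u).
  have [u u_ge0|c [u0 [u0_ge0 aff]]] := flat_edge_affine _ flat.
    by have := strict u u_ge0; lra.
  have ct : t0 < c by have := strict u0 u0_ge0; rewrite aff // ltrD2l.
  (* Half the gap, so that the greedy bound [u + t0 + e] falls below [Lambda u = u + c] at a large
     slope. *)
  pose e := (c - t0) / 2; have e_gt0 : 0 < e by rewrite /e; lra.
  have mass := gt_essinf_mass G1 e_gt0.
  have [//|x|K upper] := time_constant_le iid tc neg_null _ _ mass (a := t0 + e).
    by rewrite /= in_itv.
  have := upper (Num.max u0 K%:R); rewrite aff ?le_max ?lexx ?orbT // => /(_ isT).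
  by rewrite lerD2l /e; lra.
have [//|x ->//|K upper] := time_constant_le iid tc neg_null _ _ atom (a := t0).
apply: (@affine_flat_edge _ _ t0 (K%:R + 1)) => // u Ku.
have u_ge0 : 0 <= u by apply: le_trans Ku; rewrite addr_ge0.
apply/eqP; rewrite eq_le (time_constant_ge iid tc) // andbT upper //.
by apply: le_trans Ku; rewrite lerDl.
Qed.
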